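(* Let $k$, $k'$, $\ell$, and $t$ be positive integers. Then there exists $n_0 = n_0(k,k',\ell,t)$ such that for every integer $n \geq n_0$ the following holds. Suppose that two families $\mathcal{F} \subseteq \binom{[n]}{k}$ and $\mathcal{F}' \subseteq \binom{[n]}{k'}$ are $\ell$-weakly cross $t$-intersecting, that is, \[ \sum_{1 \leq i, j \leq \ell} \lvert F_i \cap F_j' \rvert \geq \ell^2 t - \ell + 1 \] for every choice of $\ell$ distinct members $F_1, \ldots, F_\ell \in \mathcal{F}$ and $\ell$ distinct members $F_1', \ldots, F_\ell' \in \mathcal{F}'$. Then \[ \lvert \mathcal{F} \rvert \cdot \lvert \mathcal{F}' \rvert \leq \binom{n-t}{k-t} \binom{n-t}{k'-t}. \]
   Context: For a positive integer $n$, $[n]=\{1,\dots,n\}$, and $\binom{[n]}{k}$ denotes the family of all $k$-element subsets of $[n]$.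
   Formalization: The formal theorem also assumes that each of the two families has at least ℓ members; otherwise the condition is vacuous and the bound can fail (k=k'=t=1, ℓ=2, F={{1}}, F' all singletons gives n > 1). *)

(* Defs.v *)
From mathcomp Require Import all_boot.

Set Implicit Arguments.
Unset Strict Implicit.
Unset Printing Implicit Defensive.

(* The ground set [n] is 'I_n, whose elements are numbered from 0. *)
Definition ksubsets (n k : nat) : {set {set 'I_n}} :=
  [set A : {set 'I_n} | #|A| == k].

(* Choices of l distinct members are injective families indexed by 'I_l.  For
   positive l and t we have l <= l ^ 2 * t, so the subtraction is exact.
   The condition is vacuous when F or F' has fewer than l members, whence the
   separate assumptions l <= #|F| and l <= #|F'| in the theorem. *)
Definition weakly_cross_intersecting (n l t : nat)
    (F F' : {set {set 'I_n}}) : Prop :=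
  forall A B : 'I_l -> {set 'I_n},
    injective A -> injective B ->
    (forall i, A i \in F) -> (forall j, B j \in F') ->
    l ^ 2 * t - l + 1 <= \sum_(i < l) \sum_(j < l) #|A i :&: B j|.

(* The binomial coefficient (n - t choose k - t) with its usual value 0 for
   k < t; a bare 'C(n - t, k - t) would be 1 there, subtraction on nat being
   truncated. *)
Definition shifted_bin (n k t : nat) : nat :=
  if t <= k then 'C(n - t, k - t) else 0.

(* Main.v *)
Require Import Defs.
From mathcomp Require Import all_boot perm.

(** Say that [F'] has a large star if some [t]-set [T] lies in more than
    [C * n ^ (k' - t - 1)] members of [F'], for a suitable constant [C].  Then,
    for any [A_1, ..., A_l] in [F], there are [l] members of [F'] containing
    [T] which meet the union of the [A_i] only inside [T]; the hypothesis on
    them gives [l * \sum_i #|A_i :&: T| >= l ^ 2 * t - l + 1], which forces [T]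
    into every [A_i].  Hence all members of [F] contain [T], and
    [#|F| <= 'C(n - t, k - t)].  If both families have a large star, the two
    bounds multiply to the claim.

    On the other hand, given [A_1, ..., A_l] in [F], all but [l - 1] members
    [B] of [F'] satisfy [\sum_i #|A_i :&: B| >= l * t], hence contain one of
    the boundedly many [t]-subsets of the [A_i].  Thus
    [#|F'| = O(n ^ (k' - t))], and [#|F'| = O(n ^ (k' - t - 1))] if moreover
    [F'] has no large star and [t < k'], in which case the product is too small
    anyway.  If [F'] has no large star and [k' = t], then [F] has none either,
    and one may exchange the two families unless [k = t] as well; but then
    [\sum_i #|A_i :&: B| >= l * t] makes every [A_i] equal to [B], so that [B]
    has a large star in [F], [l] members being enough for [k = t]. *)

Lemma exists_injection {T : finType} {S : {set T}} {l : nat} :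
  l <= #|S| -> exists2 f : 'I_l -> T, injective f & forall i, f i \in S.
Proof.
move=> lS; exists (fun i => enum_val (widen_ord lS i)) => [i j|i].
  by move=> /enum_val_inj[/val_inj].
exact: enum_valP.
Qed.

Lemma exists_injection_through {T : finType} {S : {set T}} {l : nat} {x : T} :
  0 < l <= #|S| -> x \in S ->
  exists f : 'I_l -> T,
    [/\ injective f, forall i, f i \in S & exists i, f i = x].
Proof.
case/andP=> l_gt0 /exists_injection[f f_inj fS] xS; pose i0 := Ordinal l_gt0.
exists (tperm (f i0) x \o f); split; last by exists i0; apply: tpermL.
- exact: inj_comp perm_inj f_inj.
- by move=> i /=; case: tpermP.
Qed.

Lemma leq_add_mulnDl (a b : nat) {s : nat} : 0 < s -> a + b * s <= (a + b) * s.
Proof. by move=> s_gt0; rewrite mulnDl leq_add2r leq_pmulr. Qed.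

Lemma exists_gt_of_sum {I : finType} {f : I -> nat} {m : nat} :
  #|I| * m < \sum_i f i -> exists i, m < f i.
Proof.
move=> lt_sum; apply/existsP; apply: contraLR lt_sum => /existsPn small.
rewrite -leqNgt -sum_nat_const; apply: leq_sum => i _.
by rewrite leqNgt small.
Qed.

Lemma card_bigcup_le {I T : finType} {P : pred I} {U : I -> {set T}} (m : nat) :
  (forall i, P i -> #|U i| <= m) -> #|\bigcup_(i | P i) U i| <= #|P| * m.
Proof.
move=> Um; apply: (@leq_trans (\sum_(i | P i) #|U i|)).
  elim/big_rec2: _ => [|i c V _ IH]; first by rewrite cards0.
  by apply: leq_trans (leq_card_setU _ _) _; rewrite leq_add2l.
by rewrite -sum_nat_const; apply: leq_sum.
Qed.

Lemma exists_subset_card {T : finType} {A : {set T}} {t : nat} :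
  t <= #|A| -> exists2 B : {set T}, B \subset A & #|B| = t.
Proof.
rewrite -bin_gt0 -cards_draws => /card_gt0P[B].
by rewrite inE => /andP[BA /eqP]; exists B.
Qed.

Lemma exists_subset_of_sum_card_setI {I T : finType} {A : I -> {set T}}
    {B : {set T}} {t : nat} :
  0 < #|I| -> #|I| * t <= \sum_i #|A i :&: B| ->
  exists S : {set T}, [/\ #|S| = t, S \subset \bigcup_i A i & S \subset B].
Proof.
move=> I_gt0 le_sum.
have [i /exists_subset_card[S]] : exists i, t <= #|A i :&: B|.
  case: t le_sum => [_|t le_sum]; first by case/card_gt0P: I_gt0 => i; exists i.
  by apply: exists_gt_of_sum; apply: leq_trans le_sum; rewrite ltn_pmul2l.
rewrite subsetI => /andP[SA SB] cS; exists S; split=> //.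
exact: subset_trans SA (bigcup_sup i _).
Qed.

Lemma subset_of_sum_card_setI {I T : finType} {A B : I -> {set T}} :
  \sum_i #|A i| <= \sum_i #|A i :&: B i| -> forall i, A i \subset B i.
Proof.
have sum_le : \sum_i #|A i :&: B i| <= \sum_i #|A i|
    ?= iff [forall i, A i :&: B i == A i].
  by apply: leqif_sum => i _; apply: subset_leqif_cards; apply: subsetIl.
rewrite (geq_leqif sum_le) => /forallP eqA i.
by apply/setIidPl/eqP.
Qed.

Lemma shifted_bin_gt0 {n k t : nat} : t <= k <= n -> 0 < shifted_bin n k t.
Proof. by case/andP=> tk kn; rewrite /shifted_bin tk bin_gt0 leq_sub2r. Qed.

Lemma shifted_bin_gt0_leq {n k t : nat} : 0 < shifted_bin n k t -> t <= k.
Proof. by rewrite /shifted_bin; case: (leqP t k). Qed.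

Lemma mul_shifted_binS_le {n k t c : nat} :
  c * k + t <= n -> c * shifted_bin n k t.+1 <= shifted_bin n k t.
Proof.
rewrite /shifted_bin => le_n; case: ltnP => [lt_tk|_]; last by rewrite muln0.
have kt_gt0 : 0 < k - t by rewrite subn_gt0.
rewrite (ltnW lt_tk) -(leq_pmul2l kt_gt0).
rewrite -[k - t in X in _ <= X]prednK // !subnS -mul_bin_diag mulnA.
rewrite leq_mul2r leq_subRL ?(leq_trans (leq_addl _ _) le_n) //.
rewrite addnC (leq_trans _ le_n) ?orbT // leq_add2r mulnC.
by rewrite leq_mul2l leq_subr orbT.
Qed.

Definition star {n : nat} (F : {set {set 'I_n}}) (T : {set 'I_n}) :
    {set {set 'I_n}} :=
  [set A in F | T \subset A].

Lemma starP {n : nat} {F : {set {set 'I_n}}} {T A : {set 'I_n}} :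
  reflect (A \in F /\ T \subset A) (A \in star F T).
Proof. by rewrite inE; apply: andP. Qed.

Lemma star_id {n : nat} {F : {set {set 'I_n}}} {T : {set 'I_n}} :
  (forall A, A \in F -> T \subset A) -> star F T = F.
Proof.
move=> FT; apply/setP=> A; apply/starP/idP => [[]//|AF].
by split; last exact: FT.
Qed.

Section Uniform.

Context {n k : nat} {F : {set {set 'I_n}}}.
Hypothesis Fk : F \subset ksubsets n k.

Lemma card_uniform {A : {set 'I_n}} : A \in F -> #|A| = k.
Proof. by move/(subsetP Fk); rewrite inE => /eqP. Qed.

Lemma card_bigcup_uniform {l : nat} {A : 'I_l -> {set 'I_n}} :
  (forall i, A i \in F) -> #|\bigcup_(i < l) A i| <= l * k.
Proof.
move=> AF; rewrite -[X in X * _]card_ord; apply: card_bigcup_le => i _.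
by rewrite (card_uniform (AF i)).
Qed.

Lemma card_star_le (T : {set 'I_n}) : #|star F T| <= shifted_bin n k #|T|.
Proof.
rewrite /shifted_bin; case: ifP => [_|/negP nTk].
  have -> : n - #|T| = #|~: T| by rewrite [in RHS]cardsCs setCK card_ord.
  rewrite -cards_draws -(@card_in_imset _ _ (fun A => A :\: T) (star F T)).
    apply/subset_leq_card/subsetP=> _ /imsetP[A /starP[AF TA] ->].
    by rewrite inE cardsDS // (card_uniform AF) eqxx andbT setDE subsetIr.
  move=> A B /starP[_ TA] /starP[_ TB] /= eqAB.
  by rewrite -(setID A T) -(setID B T) eqAB !(setIidPr _).
rewrite leqn0 cards_eq0; apply: contraT => /set0Pn[A /starP[AF TA]].
by case: nTk; rewrite -(card_uniform AF) subset_leq_card.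
Qed.

Lemma exists_star_members_avoiding {l : nat} {T X : {set 'I_n}} :
  l + #|X| * shifted_bin n k #|T|.+1 <= #|star F T| ->
  exists A : 'I_l -> {set 'I_n},
    [/\ injective A, forall i, A i \in star F T
      & forall i, A i :&: X \subset T].
Proof.
move=> large.
pose hit := \bigcup_(x in X :\: T) star F (x |: T).
have card_hit : #|hit| <= #|X| * shifted_bin n k #|T|.+1.
  apply: leq_trans (card_bigcup_le (shifted_bin n k #|T|.+1) _) _.
    move=> x; rewrite in_setD => /andP[xT _].
    by have := card_star_le (x |: T); rewrite cardsU1 xT.
  by rewrite leq_mul2r subset_leq_card ?orbT ?subsetDl.
have le_avoiding : l <= #|star F T :\: hit|.
  rewrite cardsD leq_subRL ?subset_leq_card ?subsetIl //.
  apply: leq_trans large; rewrite addnC leq_add2l.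
  exact: leq_trans (subset_leq_card (subsetIr _ _)) card_hit.
have [A A_inj A_avoid] := exists_injection le_avoiding.
have A_star i : A i \in star F T by have := A_avoid i; rewrite inE => /andP[].
exists A; split=> // i; apply/subsetP=> x; rewrite inE => /andP[xA xX].
have := A_avoid i; rewrite inE => /andP[nhit _]; apply: contraR nhit => xT.
have [AF TA] := starP (A_star i).
apply/bigcupP; exists x; first by rewrite inE xT.
by apply/starP; rewrite subUset sub1set xA.
Qed.

End Uniform.

Definition cross_families {n : nat} (l t k k' : nat) (F F' : {set {set 'I_n}}) :
    Prop :=
  [/\ F \subset ksubsets n k, F' \subset ksubsets n k', l <= #|F|, l <= #|F'|
    & weakly_cross_intersecting l t F F'].

Definition light_members {n l : nat} (t : nat) (A : 'I_l -> {set 'I_n})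
    (F : {set {set 'I_n}}) : {set {set 'I_n}} :=
  [set B in F | \sum_(i < l) #|A i :&: B| < l * t].

(** At most [l * k' * shifted_bin n k t.+1] members of the star of [T] meet a
    given union of [l] sets of size [k'] outside [T], so [l] others are left. *)
Definition has_large_star {n : nat} (l t k k' : nat) (F : {set {set 'I_n}}) :
    bool :=
  [exists T : {set 'I_n},
    (#|T| == t) && (l + l * k' * shifted_bin n k t.+1 <= #|star F T|)].

(** The factors in front of [k'] are the constants of [card_le_of_cross], for
    the exchanged pair, and of [card_le_of_no_large_star]. *)
Definition threshold (l t k k' : nat) : nat :=
  (l + 'C(l * k', t)) * (l + 'C(l * k, t) * (l + l * k)) * k' + t.

Section CrossFamilies.

Context {n l t : nat}.
Hypotheses (l_gt0 : 0 < l) (t_gt0 : 0 < t).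

Lemma cross_families_sym {k k' : nat} {F F' : {set {set 'I_n}}} :
  cross_families l t k k' F F' -> cross_families l t k' k F' F.
Proof.
case=> Fk F'k lF lF' FF'; split=> // A B A_inj B_inj AF' BF.
apply: leq_trans (FF' B A B_inj A_inj BF AF') _.
rewrite exchange_big /=.
by apply: leq_sum => i _; apply: leq_sum => j _; rewrite setIC.
Qed.

Lemma has_large_star_tight {k' : nat} {F : {set {set 'I_n}}} {T : {set 'I_n}} :
  #|T| = t -> l <= #|star F T| -> has_large_star l t t k' F.
Proof.
move=> cT le_l; apply/existsP; exists T.
by rewrite cT eqxx /shifted_bin ltnn muln0 addn0.
Qed.

Section Pair.

Context {k k' : nat} {F F' : {set {set 'I_n}}}.
Hypothesis cross : cross_families l t k k' F F'.

Lemma exists_heavy_column {A B : 'I_l -> {set 'I_n}} :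
  injective A -> injective B ->
  (forall i, A i \in F) -> (forall j, B j \in F') ->
  exists j, l * t <= \sum_(i < l) #|A i :&: B j|.
Proof.
move=> A_inj B_inj AF BF'; have lt_gt0 : 0 < l * t by rewrite muln_gt0 l_gt0.
have [|j] := exists_gt_of_sum
  (f := fun j => \sum_(i < l) #|A i :&: B j|) (m := (l * t).-1).
  have [_ _ _ _ /(_ A B A_inj B_inj AF BF')] := cross.
  by rewrite exchange_big card_ord -subn1 mulnBr muln1 mulnA addn1.
by rewrite prednK //; exists j.
Qed.

Lemma card_light_members_lt {A : 'I_l -> {set 'I_n}} :
  injective A -> (forall i, A i \in F) -> #|light_members t A F'| < l.
Proof.
move=> A_inj AF; rewrite ltnNge; apply/negP.
case/exists_injection=> B B_inj B_light.
have BF' j : B j \in F' by have := B_light j; rewrite inE => /andP[].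
have [j] := exists_heavy_column A_inj B_inj AF BF'.
by rewrite leqNgt; have := B_light j; rewrite inE => /andP[_ ->].
Qed.

Lemma card_lt_of_star_le (D : nat) :
  (forall T : {set 'I_n}, #|T| = t -> #|star F' T| <= D) ->
  #|F'| < l + 'C(l * k, t) * D.
Proof.
move=> star_le; have [Fk _ lF _ _] := cross.
have [A A_inj AF] := exists_injection lF.
pose X := \bigcup_(i < l) A i.
pose draws := [set T : {set 'I_n} | T \subset X & #|T| == t].
have cover : F' \subset light_members t A F' :|: \bigcup_(T in draws) star F' T.
  apply/subsetP=> B BF'; rewrite in_setU inE BF' /=; case: ltnP => //= heavy.
  have [||T [cT TX TB]] :=
    exists_subset_of_sum_card_setI (A := A) (B := B) (t := t);
    rewrite ?card_ord //.
  by apply/bigcupP; exists T; [rewrite inE TX cT eqxx | apply/starP].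
apply: leq_ltn_trans (subset_leq_card cover) _.
apply: leq_ltn_trans (leq_card_setU _ _) _; rewrite -addSn.
apply: leq_add; first exact: card_light_members_lt.
apply: leq_trans (card_bigcup_le D _) _ => [T|].
  by rewrite inE => /andP[_ /eqP]; apply: star_le.
rewrite leq_mul2r [#|_|]cards_draws leq_bin2l ?orbT //.
exact: (card_bigcup_uniform Fk AF).
Qed.

Lemma card_lt_of_cross : #|F'| < l + 'C(l * k, t) * shifted_bin n k' t.
Proof.
have [_ F'k _ _ _] := cross.
by apply: card_lt_of_star_le => T <-; apply: card_star_le.
Qed.

Lemma shifted_bin_gt0_of_cross : 0 < shifted_bin n k' t.
Proof.
have [_ _ _ lF' _] := cross; rewrite lt0n.
by apply: contraTneq card_lt_of_cross => ->; rewrite muln0 addn0 -leqNgt.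
Qed.

Lemma card_le_of_cross : #|F'| <= (l + 'C(l * k, t)) * shifted_bin n k' t.
Proof.
apply: leq_trans (ltnW card_lt_of_cross) _.
exact: leq_add_mulnDl shifted_bin_gt0_of_cross.
Qed.

Lemma card_le_of_no_large_star :
  t < k' -> ~~ has_large_star l t k' k F' ->
  #|F'| <= (l + 'C(l * k, t) * (l + l * k)) * shifted_bin n k' t.+1.
Proof.
move=> lt_tk' /existsPn small; have [_ F'k _ lF' _] := cross.
have /card_gt0P[B BF'] : 0 < #|F'| by apply: leq_trans lF'.
have sb_gt0 : 0 < shifted_bin n k' t.+1.
  apply: shifted_bin_gt0; rewrite lt_tk' -(card_uniform F'k BF').
  by rewrite -[X in _ <= X]card_ord max_card.
pose D := l + l * k * shifted_bin n k' t.+1.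
apply: leq_trans (ltnW (card_lt_of_star_le D _)) _.
  by move=> T cT; have := small T; rewrite cT eqxx -ltnNge => /ltnW.
apply: leq_trans (leq_add_mulnDl _ _ sb_gt0).
by rewrite leq_add2l -[X in _ <= X]mulnA leq_mul2l leq_add_mulnDl ?orbT.
Qed.

Lemma subset_of_large_star {T : {set 'I_n}} :
  #|T| = t -> l + l * k * shifted_bin n k' t.+1 <= #|star F' T| ->
  forall A, A \in F -> T \subset A.
Proof.
move=> cT large A0 A0F; have [Fk F'k lF _ _] := cross.
have [|A [A_inj AF [i0 <-]]] := exists_injection_through (l := l) _ A0F.
  by rewrite l_gt0.
pose X := \bigcup_(i < l) A i.
have [|B [B_inj B_star BXT]] :=
  exists_star_members_avoiding F'k (l := l) (T := T) (X := X).
  apply: leq_trans large; rewrite cT leq_add2l leq_mul2r.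
  by rewrite (card_bigcup_uniform Fk AF) orbT.
have BF' j : B j \in F' by have [] := starP (B_star j).
have [j heavy] := exists_heavy_column A_inj B_inj AF BF'.
apply: (subset_of_sum_card_setI (A := fun=> T)) i0.
rewrite sum_nat_const card_ord cT (leq_trans heavy) //.
apply: leq_sum => i _; apply: subset_leq_card.
rewrite subsetI subsetIl andbT (subset_trans _ (BXT j)) // setIC.
by rewrite setIS // bigcup_sup.
Qed.

Lemma exists_star_of_large_star :
  has_large_star l t k' k F' ->
  exists2 T : {set 'I_n}, #|T| = t & star F T = F.
Proof.
case/existsP=> T /andP[/eqP cT large]; exists T => //.
exact: star_id (subset_of_large_star cT large).
Qed.

Lemma card_le_of_large_star :
  has_large_star l t k' k F' -> #|F| <= shifted_bin n k t.
Proof.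
case/exists_star_of_large_star=> T <- <-; have [Fk _ _ _ _] := cross.
exact: card_star_le.
Qed.

Lemma has_large_star_tight_of_cross :
  k = t -> has_large_star l t k' k F' -> has_large_star l t k k' F.
Proof.
move=> kt /exists_star_of_large_star[T cT starT]; have [_ _ lF _ _] := cross.
by rewrite kt; apply: (has_large_star_tight cT); rewrite starT.
Qed.

Lemma has_large_star_both_tight :
  k = t -> k' = t -> has_large_star l t k k' F.
Proof.
move=> kt k't; have [Fk F'k lF lF' _] := cross.
have [A A_inj AF] := exists_injection lF.
have [B B_inj BF'] := exists_injection lF'.
have [j heavy] := exists_heavy_column A_inj B_inj AF BF'.
have cA i : #|A i| = t by rewrite (card_uniform Fk (AF i)).
have cB : #|B j| = t by rewrite (card_uniform F'k (BF' j)).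
have AB : forall i, A i \subset B j.
  apply: (subset_of_sum_card_setI (B := fun=> B j)); apply: leq_trans heavy.
  by rewrite (eq_bigr _ (fun i _ => cA i)) sum_nat_const card_ord.
rewrite kt; apply: (has_large_star_tight cB).
rewrite -[l]card_ord -(card_imset _ A_inj).
apply/subset_leq_card/subsetP=> _ /imsetP[i _ ->]; apply/starP.
split; first exact: AF.
by rewrite -(geq_leqif (subset_leqif_card (AB i))) cA cB.
Qed.

End Pair.

Lemma card_mul_le_of_no_large_star_lt {k k' : nat} {F F' : {set {set 'I_n}}} :
  cross_families l t k k' F F' -> threshold l t k k' <= n -> t < k' ->
  ~~ has_large_star l t k' k F' ->
  #|F| * #|F'| <= shifted_bin n k t * shifted_bin n k' t.
Proof.
move=> cross le_n lt_tk' no_large.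
have le_F := card_le_of_cross (cross_families_sym cross).
have le_F' := card_le_of_no_large_star cross lt_tk' no_large.
apply: leq_trans (leq_mul le_F le_F') _.
rewrite mulnACA [X in _ * X <= _]mulnC mulnA [X in _ <= X]mulnC leq_mul2r.
by rewrite mul_shifted_binS_le ?orbT.
Qed.

Lemma card_mul_le_of_no_large_star {k k' : nat} {F F' : {set {set 'I_n}}} :
  cross_families l t k k' F F' ->
  threshold l t k k' <= n -> threshold l t k' k <= n ->
  ~~ has_large_star l t k' k F' ->
  #|F| * #|F'| <= shifted_bin n k t * shifted_bin n k' t.
Proof.
move=> cross le_n le_n' no_large; have cross' := cross_families_sym cross.
have le_tk' := shifted_bin_gt0_leq (shifted_bin_gt0_of_cross cross).
have le_tk := shifted_bin_gt0_leq (shifted_bin_gt0_of_cross cross').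
case: ltngtP le_tk' => // [lt_tk' _|tk' _].
  exact: card_mul_le_of_no_large_star_lt.
have no_large' : ~~ has_large_star l t k k' F.
  by apply: contra no_large; apply: has_large_star_tight_of_cross.
case: ltngtP le_tk => // [lt_tk _|tk _].
  rewrite mulnC [X in _ <= X]mulnC.
  exact: card_mul_le_of_no_large_star_lt cross' _ _ _.
by rewrite (has_large_star_both_tight cross') in no_large.
Qed.

End CrossFamilies.

Theorem theorem1p2 (k k' l t : nat)
    (k_gt0 : 0 < k) (k'_gt0 : 0 < k') (l_gt0 : 0 < l) (t_gt0 : 0 < t) :
  exists n0 : nat, forall n : nat, n0 <= n ->
  forall F F' : {set {set 'I_n}},
    F \subset ksubsets n k -> F' \subset ksubsets n k' ->
    l <= #|F| -> l <= #|F'| ->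
    weakly_cross_intersecting l t F F' ->
    #|F| * #|F'| <= shifted_bin n k t * shifted_bin n k' t.
Proof.
exists (maxn (threshold l t k k') (threshold l t k' k)) => n.
rewrite geq_max => /andP[le_n le_n'] F F' Fk F'k lF lF' FF'.
have cross : cross_families l t k k' F F' by split.
have cross' := cross_families_sym cross.
have [large'|no_large'] := boolP (has_large_star l t k' k F'); last first.
  exact: (card_mul_le_of_no_large_star l_gt0 t_gt0 cross).
have [large|no_large] := boolP (has_large_star l t k k' F); last first.
  rewrite mulnC [X in _ <= X]mulnC.
  exact: (card_mul_le_of_no_large_star l_gt0 t_gt0 cross').
apply: leq_mul.
  exact: (card_le_of_large_star l_gt0 t_gt0 cross large').
exact: (card_le_of_large_star l_gt0 t_gt0 cross' large).
Qed.
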